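(* Let $A\to M$ be a Lie algebroid, let $(\mathcal{B},Q)$ be an $A$-module, and let $(\mathcal{B}^*,Q^* )$ be the dual $A$-module. The pairing $\langle\cdot,\cdot\rangle:\Gamma(\mathcal{B}^* )\otimes\Gamma(\mathcal{B})\to\Omega(A)$ induces a well-defined cohomology pairing $$H^\bullet(A;\mathcal{B}^* )\otimes H^\bullet(A;\mathcal{B})\to H^\bullet(A),\qquad [b]\otimes[\beta]\mapsto[\langle b,\beta\rangle].$$
   Context: $A[1]$ is the graded manifold with $C^\infty(A[1])=\Omega(A):=\bigwedge\Gamma(A^* )$, with Lie algebroid differential $d_A$; $H^\bullet(A)$ is the cohomology of $(\Omega(A),d_A)$. A vector bundle $\mathcal{B}\to A[1]$ in the category of graded manifolds is given by its sheaf of sections $\Gamma(\mathcal{B})$, a locally free $\mathbb{Z}$-graded $\Omega(A)$-module, of finite rank in each degree and with ranks vanishing in degrees sufficiently small or in degrees sufficiently large (or both). An $A$-module is such a $\mathcal{B}$ with a degree $1$ operator $Q$ on $\Gamma(\mathcal{B})$ satisfying $Q^2=0$ and $Q(\alpha\beta)=(d_A\alpha)\beta+(-1)^p\alpha(Q\beta)$ for $\alpha\in\Omega^p(A)$, $\beta\in\Gamma(\mathcal{B})$. The cohomology of $A$ with values in $\mathcal{B}$, denoted $H^\bullet(A;\mathcal{B})$, is the cohomology of the complex $(\Gamma(\mathcal{B}),Q)$. $\mathcal{B}^*\to A[1]$ is the dual vector bundle, with natural degree-preserving pairing $\langle\cdot,\cdot\rangle:\Gamma(\mathcal{B}^* )\otimes\Gamma(\mathcal{B})\to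 C^\infty(A[1])=\Omega(A)$. The dual $A$-module structure $Q^*$ on $\mathcal{B}^*$ is uniquely determined by $$d_A\langle b,\beta\rangle=\langle Q^*b,\beta\rangle+(-1)^{|b|}\langle b,Q\beta\rangle$$ for homogeneous $b\in\Gamma(\mathcal{B}^* )$ and all $\beta\in\Gamma(\mathcal{B})$. *)

(* Defs.v *)
From HB Require Import structures.
From mathcomp Require Import all_boot all_order all_algebra all_fingroup.
From mathcomp Require Import sesquilinear.
From mathcomp Require Import all_classical all_reals all_analysis.

Set Implicit Arguments.
Unset Strict Implicit.
Unset Printing Implicit Defensive.

Import Order.TTheory GRing.Theory Num.Theory.
Import numFieldNormedType.Exports.

Local Open Scope classical_set_scope.
Local Open Scope ring_scope.

(** * Smooth functions on open subsets of R^n *)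

Section Ck.
Variables (R : realType) (n : nat).
Implicit Types (S : set 'rV[R]_n) (f g : 'rV[R]_n -> R^o).

Definition cont_on S f := forall x, S x -> {for x, continuous f}.

Fixpoint Ck (k : nat) S f : Prop :=
  match k with
  | 0%N => cont_on S f
  | k'.+1 => cont_on S f /\
      forall i : 'I_n,
        (forall x, S x -> derivable f x 'e_i) /\
        Ck k' S (fun x => 'D_'e_i f x)
  end.

Definition smooth S f := forall k, Ck k S f.

Lemma Ck_cont k S f : Ck k S f -> cont_on S f.
Proof. by case: k => [//|k] []. Qed.

Lemma Ck_pred k S f : Ck k.+1 S f -> Ck k S f.
Proof.
elim: k f => [|k IH] f; first by case.
by move=> [fc H]; split=> // i; have [Hd HC] := H i; split=> //; apply: IH.
Qed.

Lemma Ck_mono k S S' f : S' `<=` S -> Ck k S f -> Ck k S' f.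
Proof.
move=> sub; elim: k f => [|k IH] f /=; first by move=> h x /sub; exact: h.
move=> [fc H]; split=> [x /sub|i]; first exact: fc.
by have [Hd HC] := H i; split=> [x /sub|]; [exact: Hd|exact: IH].
Qed.

Lemma near_congr S f g : open S -> (forall x, S x -> f x = g x) ->
  forall x, S x -> \near x, f x = g x.
Proof.
move=> oS fg x Sx; near=> y; apply: fg; near: y.
exact: open_nbhs_nbhs.
Unshelve. all: by end_near. Qed.

Lemma Ck_congr k S f g : open S -> (forall x, S x -> f x = g x) ->
  Ck k S f -> Ck k S g.
Proof.
move=> oS; elim: k f g => [|k IH] f g fg /=.
  move=> fc x Sx; rewrite /prop_for /continuous_at -(fg x Sx).
  exact: cvg_trans (near_eq_cvg (near_congr oS fg Sx)) (fc x Sx).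
move=> [fc H]; split=> [x Sx|i].
  rewrite /prop_for /continuous_at -(fg x Sx).
  exact: cvg_trans (near_eq_cvg (near_congr oS fg Sx)) (fc x Sx).
have [Hd HC] := H i; split=> [x Sx|].
  exact: near_eq_derivable (near_congr oS fg Sx) (Hd x Sx).
apply: IH HC => x Sx; exact: near_eq_derive (near_congr oS fg Sx).
Qed.

Lemma Ck_cst k S (c : R) : Ck k S (cst c).
Proof.
elim: k c => [|k IH] c /=; first by move=> x _; exact: cst_continuous.
split=> [x _|i]; first exact: cst_continuous.
split=> [x _|]; first exact: derivable_cst.
rewrite (_ : (fun x => _) = cst 0) //.
by apply/funext => x; rewrite derive_cst.
Qed.

Lemma Ck_add k S f g : open S -> Ck k S f -> Ck k S g -> Ck k S (f + g).
Proof.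
move=> oS; elim: k f g => [|k IH] f g /=.
  by move=> fc gc x Sx; apply: continuousD; [exact: fc|exact: gc].
move=> [fc Hf] [gc Hg]; split=> [x Sx|i].
  by apply: continuousD; [exact: fc|exact: gc].
have [fd fC] := Hf i; have [gd gC] := Hg i; split=> [x Sx|].
  by apply: derivableD; [exact: fd|exact: gd].
apply: Ck_congr (IH _ _ fC gC) => // x Sx.
by rewrite deriveD //; [exact: fd|exact: gd].
Qed.

Lemma Ck_mul k S f g : open S -> Ck k S f -> Ck k S g ->
  Ck k S (fun x => f x * g x).
Proof.
move=> oS; elim: k f g => [|k IH] f g /=.
  by move=> fc gc x Sx; apply: continuousM; [exact: fc|exact: gc].
move=> Hf' Hg'; have [fc Hf] := Hf'; have [gc Hg] := Hg'.
split=> [x Sx|i].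
  by apply: continuousM; [exact: fc|exact: gc].
have [fd fC] := Hf i; have [gd gC] := Hg i; split=> [x Sx|].
  by apply: (@derivableM _ _ f g); [exact: fd|exact: gd].
apply: Ck_congr (Ck_add oS (IH _ _ (Ck_pred Hf') gC)
  (IH _ _ (Ck_pred Hg') fC)) => // x Sx.
by rewrite [RHS](@deriveM _ _ f g) //; [exact: fd|exact: gd].
Qed.

End Ck.

(** * Smooth manifolds *)

Record chart (R : realType) (n : nat) (M : topologicalType) := Chart {
  dom : set M;
  cod : set 'rV[R]_n;
  cmap : M -> 'rV[R]_n;
  cinv : 'rV[R]_n -> M;
  open_dom : open dom;
  open_cod : open cod;
  cmap_cod : forall x, dom x -> cod (cmap x);
  cinv_dom : forall y, cod y -> dom (cinv y);
  cmapK : forall x, dom x -> cinv (cmap x) = x;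
  cinvK : forall y, cod y -> cmap (cinv y) = y;
  cmap_cont : forall x, dom x -> {for x, continuous cmap};
  cinv_cont : forall y, cod y -> {for y, continuous cinv} }.

Record manifold (R : realType) (n : nat) := Manifold {
  carrier :> topologicalType;
  carrier_hausdorff : hausdorff_space carrier;
  carrier_second_countable : @second_countable carrier;
  atlas : set (chart R n carrier);
  atlas_cover : forall x, exists2 c, atlas c & dom c x;
  atlas_smooth : forall c c', atlas c -> atlas c' -> forall i : 'I_n,
    smooth [set y | cod c y /\ dom c' (cinv c y)]
           (fun y => cmap c' (cinv c y) 0 i) }.

Record opens (M : topologicalType) := Opens {
  oset :> set M;
  osetP : open oset }.

Definition oset_fun (M : topologicalType) (U : opens M) : M -> Prop := oset U.
Coercion oset_fun : opens >-> Funclass.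

Definition oT (M : topologicalType) : opens M := Opens (@openT M).

Section SmoothFun.
Variables (R : realType) (n : nat) (M : manifold R n).

Definition smooth_fun (U : set M) (f : M -> R) :=
  forall c, atlas c ->
    smooth [set y | cod c y /\ U (cinv c y)] (fun y => f (cinv c y)).

Lemma open_chart_preimage (c : chart R n M) (U : set M) :
  open U -> open [set y | cod c y /\ U (cinv c y)].
Proof.
move=> oU; rewrite openE => y [cy Uy]; apply: filterI.
  by apply: open_nbhs_nbhs; split=> //; exact: open_cod.
by apply: (cinv_cont cy); apply: open_nbhs_nbhs.
Qed.

Lemma smooth_fun_mono (U V : set M) f :
  V `<=` U -> smooth_fun U f -> smooth_fun V f.
Proof. by move=> VU fU c ac k; apply: Ck_mono (fU c ac k) => y [? /VU]. Qed.

Lemma smooth_fun_congr (U : set M) f g : open U ->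
  (forall x, U x -> f x = g x) -> smooth_fun U f -> smooth_fun U g.
Proof.
move=> oU fg fU c ac k; apply: Ck_congr (fU c ac k).
  exact: open_chart_preimage.
by move=> y [_ /fg].
Qed.

Lemma smooth_fun_cst (U : set M) (a : R) : smooth_fun U (fun=> a).
Proof. by move=> c ac k; exact: Ck_cst. Qed.

Lemma smooth_funD (U : set M) f g : open U ->
  smooth_fun U f -> smooth_fun U g -> smooth_fun U (fun x => f x + g x).
Proof.
move=> oU fU gU c ac k; apply: Ck_add (fU c ac k) (gU c ac k).
exact: open_chart_preimage.
Qed.

Lemma smooth_funM (U : set M) f g : open U ->
  smooth_fun U f -> smooth_fun U g -> smooth_fun U (fun x => f x * g x).
Proof.
move=> oU fU gU c ac k; apply: Ck_mul (fU c ac k) (gU c ac k).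
exact: open_chart_preimage.
Qed.

Lemma smooth_fun_sum (U : set M) (I : Type) (r : seq I) (F : I -> M -> R) :
  open U -> (forall i, smooth_fun U (F i)) ->
  smooth_fun U (fun x => \sum_(i <- r) F i x).
Proof.
move=> oU FU; elim: r => [|i r IH].
  by apply: smooth_fun_congr (smooth_fun_cst U 0) => // x _; rewrite big_nil.
apply: smooth_fun_congr (smooth_funD oU (FU i) IH) => // x _.
by rewrite big_cons.
Qed.

(** A tangent vector at [x], as a derivation at [x] of the smooth functions. *)
Record is_tangent (x : M) (D : (M -> R) -> R) : Prop := IsTangent {
  tangent_linear : forall (a : R) f g, smooth_fun setT f -> smooth_fun setT g ->
    D (fun y => a * f y + g y) = a * D f + D g;
  tangent_leibniz : forall f g, smooth_fun setT f -> smooth_fun setT g ->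
    D (fun y => f y * g y) = D f * g x + f x * D g }.

End SmoothFun.

(** * Vector bundles, given by fibres and an atlas of local frames *)

Record vbundle (R : realType) (n : nat) (M : manifold R n) := VBundle {
  fib :> M -> vectType R;
  triv : Type;
  tdom : triv -> set M;
  trank : triv -> nat;
  frame : forall (i : triv) (x : M), (trank i).-tuple (fib x);
  tdom_open : forall i, open (tdom i);
  tdom_cover : forall x, exists i, tdom i x;
  frame_basis : forall i x, tdom i x -> basis_of {:fib x} (frame i x);
  frame_smooth : forall i j a b,
    smooth_fun (tdom i `&` tdom j)
               (fun x => coord (frame j x) b (tnth (frame i x) a)) }.

Definition section (R : realType) (n : nat) (M : manifold R n)
  (A : vbundle M) := forall x : M, A x.

Definition smooth_section (R : realType) (n : nat) (M : manifold R n)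
    (A : vbundle M) (s : section A) :=
  forall (i : triv A) a, smooth_fun (tdom i) (fun x => coord (frame i x) a (s x)).

(** * The sheaf of graded algebras Omega(A)

   [form A U p] is the space of smooth sections of the [p]-th exterior power of
   the dual of [A] over the open set [U]: families of alternating [p]-linear
   forms on the fibres of [A].  A form over [U] is stored as a function on all of
   [M], extended by zero outside [U], so that equality of forms over [U] is
   equality. *)

Section Forms.
Variables (R : realType) (n : nat) (M : manifold R n) (A : vbundle M).

Definition args p := {x : M & 'I_p -> A x}.

Definition mkargs p x (v : 'I_p -> A x) : args p :=
  Tagged (fun x => 'I_p -> A x) v.

Definition upd (T : Type) p (v : 'I_p -> T) (i : 'I_p) (u : T) : 'I_p -> T :=
  fun k => if k == i then u else v k.

Record is_form (U : opens M) p (w : args p -> R^o) : Prop := IsForm {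
  form_out : forall t, ~ U (tag t) -> w t = 0;
  form_multilinear : forall x (v : 'I_p -> A x) i (a : R) (u u' : A x),
    w (mkargs (upd v i (a *: u + u'))) =
      a * w (mkargs (upd v i u)) + w (mkargs (upd v i u'));
  form_alternating : forall x (v : 'I_p -> A x) i j, i != j -> v i = v j ->
    w (mkargs v) = 0;
  form_smooth : forall (i : triv A) (h : 'I_p -> 'I_(trank i)),
    smooth_fun (U `&` tdom i)
      (fun x => w (mkargs (fun k => tnth (frame i x) (h k)))) }.

Definition form_pred U p : {pred args p -> R^o} := fun w => `[< is_form U w >].
Arguments form_pred : clear implicits.

Lemma form_predP U p (w : args p -> R^o) :
  reflect (is_form U w) (w \in form_pred U p).
Proof. exact: asboolP. Qed.

Lemma open_tdomI (U : opens M) (i : triv A) : open (U `&` tdom i).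
Proof. by apply: openI; [exact: osetP|exact: tdom_open]. Qed.

Lemma form_submod U p : submod_closed (form_pred U p).
Proof.
split=> [|a w w' /form_predP hw /form_predP hw']; apply/form_predP.
  split=> //= [x v i a u u'|i h]; first by rewrite mulr0 addr0.
  exact: smooth_fun_cst.
split=> [t Ut|x v i b u u'|x v i j ij vij|i h].
- by rewrite -[LHS]/(a * w t + w' t) (form_out hw Ut) (form_out hw' Ut)
     mulr0 addr0.
- rewrite -![(a *: w + w') _]/(a * w _ + w' _).
  rewrite (form_multilinear hw) (form_multilinear hw') !mulrDr !mulrA.
  by rewrite (mulrC a b) addrACA.
- rewrite -[LHS]/(a * w _ + w' _).
  by rewrite (form_alternating hw ij vij) (form_alternating hw' ij vij)
     mulr0 addr0.
- apply: smooth_funD; first exact: open_tdomI.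
    apply: smooth_funM; [exact: open_tdomI|exact: smooth_fun_cst|].
    exact: form_smooth hw _ _.
  exact: form_smooth hw' _ _.
Qed.

HB.instance Definition _ U p :=
  GRing.isSubmodClosed.Build R (args p -> R^o) (form_pred U p)
    (form_submod U p).

Record form (U : opens M) p := Form {
  fval : args p -> R^o;
  fvalP : fval \in form_pred U p }.

HB.instance Definition _ U p := [isSub for @fval U p].
HB.instance Definition _ U p := [Choice of form U p by <:].
HB.instance Definition _ U p := [SubChoice_isSubLmodule of form U p by <:].

Definition ev U p (w : form U p) (x : M) (v : 'I_p -> A x) : R :=
  fval w (mkargs v).

Definition res_raw (V : opens M) p (w : args p -> R^o) : args p -> R^o :=
  fun t => \1_V (tag t) * w t.

Lemma res_is_form (U V : opens M) p (w : form U p) :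
  V `<=` U -> res_raw V (fval w) \in form_pred V p.
Proof.
move=> VU; have /form_predP hw := fvalP w; apply/form_predP.
rewrite /res_raw; split=> [t Vt|x v i b u u'|x v i j ij vij|i h] /=.
- by rewrite indicE memNset ?mul0r.
- by rewrite (form_multilinear hw) mulrDr mulrCA.
- by rewrite (form_alternating hw ij vij) mulr0.
- apply: smooth_fun_congr
    (smooth_fun_mono _ (form_smooth hw h)); first exact: open_tdomI.
    by move=> x [Vx _]; rewrite indicE mem_set ?mul1r.
  by move=> x [/VU].
Qed.

Definition fres (U V : opens M) (VU : V `<=` U) p (w : form U p) : form V p :=
  Form (res_is_form w VU).

Definition one_raw (U : opens M) : args 0 -> R^o := fun t => \1_U (tag t).

Lemma one_is_form U : one_raw U \in form_pred U 0.
Proof.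
apply/form_predP; split=> [t Ut|x v []//|x v []//|i h].
  by rewrite /one_raw indicE memNset.
apply: smooth_fun_congr (smooth_fun_cst _ 1); first exact: open_tdomI.
by move=> x [Ux _]; rewrite /one_raw indicE mem_set.
Qed.

Definition fone U : form U 0 := Form (one_is_form U).

(** Normalised so that the wedge of two 1-forms is
    [alpha(u) beta(v) - alpha(v) beta(u)]. *)
Definition wedge_raw p q (w : args p -> R^o) (w' : args q -> R^o) :
    args (p + q) -> R^o :=
  fun t => (p`! * q`!)%:R^-1 *
    \sum_(s : 'S_(p + q)) (-1) ^+ s *
      (w (mkargs (fun k => tagged t (s (lshift q k)))) *
       w' (mkargs (fun k => tagged t (s (rshift p k))))).

Lemma upd_perm (T : Type) p q (f : 'I_q -> 'I_p) (v : 'I_p -> T) k u :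
  injective f -> (fun l => upd v (f k) u (f l)) = upd (v \o f) k u.
Proof. by move=> fI; apply/funext => l; rewrite /upd (inj_eq fI). Qed.

Lemma upd_out (T : Type) p q (f : 'I_q -> 'I_p) (v : 'I_p -> T) i u :
  (forall l, f l != i) -> (fun l => upd v i u (f l)) = v \o f.
Proof. by move=> fi; apply/funext => l; rewrite /upd (negbTE (fi l)). Qed.

Lemma wedge_is_form U p q (w : form U p) (w' : form U q) :
  wedge_raw (fval w) (fval w') \in form_pred U (p + q).
Proof.
have /form_predP hw := fvalP w; have /form_predP hw' := fvalP w'.
apply/form_predP.
rewrite /wedge_raw; split=> [t Ut|x v i a u u'|x v i j ij vij|i h] /=.
- rewrite big1 ?mulr0// => s _.
  by rewrite [fval w _](form_out hw) ?mul0r ?mulr0.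
- rewrite mulrCA -mulrDr; congr (_ * _).
  rewrite mulr_sumr -big_split; apply: eq_bigr => s _ /=.
  have slI : injective (s \o @lshift p q).
    by apply: inj_comp; [exact: perm_inj|exact: lshift_inj].
  have srI : injective (s \o @rshift p q).
    by apply: inj_comp; [exact: perm_inj|exact: rshift_inj].
  have [k Ek|k Ek] := split_ordP (s^-1%g i).
    have Ei : i = (s \o @lshift p q) k by rewrite /= -Ek permKV.
    have Hr l : (s \o @rshift p q) l != i.
      by rewrite Ei /= (inj_eq perm_inj) eq_rlshift.
    rewrite !(upd_out _ _ Hr) {Hr} Ei !(upd_perm _ _ _ slI).
    by rewrite (form_multilinear hw) mulrDl mulrDr -!mulrA; congr (_ + _);
       rewrite mulrCA.
  have Ei : i = (s \o @rshift p q) k by rewrite /= -Ek permKV.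
  have Hl l : (s \o @lshift p q) l != i.
    by rewrite Ei /= (inj_eq perm_inj) eq_lrshift.
  rewrite !(upd_out _ _ Hl) {Hl} Ei !(upd_perm _ _ _ srI).
  rewrite (form_multilinear hw') !mulrDr; congr (_ + _).
  by rewrite [RHS]mulrCA; congr (_ * _); rewrite mulrCA.
- set S := \sum_s _; suff S0 : S = - S.
    have /eqP : S *+ 2 = 0 by rewrite mulr2n {1}S0 addNr.
    by rewrite mulrn_eq0 /= => /eqP ->; rewrite mulr0.
  rewrite {1}/S (reindex_inj (mulIg (tperm i j))) /= -sumrN.
  apply: eq_bigr => s _; rewrite odd_permM odd_tperm ij signr_addb expr1.
  have E k : v ((s * tperm i j)%g k) = v (s k).
    by rewrite permM; case: tpermP => [->|->|//].
  rewrite mulrN1 mulNr; congr (- (_ * (_ * _))).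
    by congr (fval w (mkargs _)); apply/funext => k; exact: E.
  by congr (fval w' (mkargs _)); apply/funext => k; exact: E.
- apply: smooth_funM; [exact: open_tdomI|exact: smooth_fun_cst|].
  apply: smooth_fun_sum => [|s]; first exact: open_tdomI.
  apply: smooth_funM; [exact: open_tdomI|exact: smooth_fun_cst|].
  apply: smooth_funM; first exact: open_tdomI.
    exact: (form_smooth hw (fun k => h (s (lshift q k)))).
  exact: (form_smooth hw' (fun k => h (s (rshift p k)))).
Qed.

Definition wedge U p q (w : form U p) (w' : form U q) : form U (p + q) :=
  Form (wedge_is_form w w').

(** Omega(A) graded by the integers, zero in negative degrees. *)
Definition Om (U : opens M) (k : int) : lmodType R :=
  match k with
  | Posz p => form U p
  | Negz _ => 'rV[R]_0
  end.

Definition Om_res (U V : opens M) (VU : V `<=` U) (k : int) :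
    Om U k -> Om V k :=
  match k with
  | Posz p => @fres U V VU p
  | Negz _ => fun w => w
  end.

Definition Om_wedge (U : opens M) (p : nat) (k l : int) (e : p%:Z + k = l)
    (w : form U p) : Om U k -> Om U l :=
  match k return p%:Z + k = l -> Om U k -> Om U l with
  | Posz q => fun e w' =>
      eq_rect (Posz (p + q)) (fun m => Om U m) (wedge w w') l e
  | Negz _ => fun _ _ => 0
  end e.

End Forms.

(** * Lie algebroids

   The bracket is constrained on smooth sections only, the anchor on smooth
   functions only.  Compatibility of the anchor with the brackets is a
   consequence of the Jacobi and Leibniz identities. *)

Record lie_algebroid (R : realType) (n : nat) (M : manifold R n)
    (A : vbundle M) := LieAlgebroid {
  bracket : section A -> section A -> section A;
  anchor : forall x, A x -> (M -> R) -> R;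
  anchor_linear : forall x (a : R) (u v : A x) f, smooth_fun setT f ->
    anchor (a *: u + v) f = a * anchor u f + anchor v f;
  anchor_tangent : forall x (v : A x), is_tangent x (anchor v);
  anchor_smooth : forall s f, smooth_section s -> smooth_fun setT f ->
    smooth_fun setT (fun x => anchor (s x) f);
  bracket_smooth : forall s t, smooth_section s -> smooth_section t ->
    smooth_section (bracket s t);
  bracket_linear : forall (a : R) s s' t,
    smooth_section s -> smooth_section s' -> smooth_section t ->
    forall x, bracket (fun y => a *: s y + s' y) t x =
              a *: bracket s t x + bracket s' t x;
  bracket_antisym : forall s t, smooth_section s -> smooth_section t ->
    forall x, bracket s t x = - bracket t s x;
  bracket_jacobi : forall s t u,
    smooth_section s -> smooth_section t -> smooth_section u ->
    forall x, bracket s (bracket t u) x + bracket t (bracket u s) x +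
              bracket u (bracket s t) x = 0;
  bracket_leibniz : forall s t f,
    smooth_section s -> smooth_section t -> smooth_fun setT f ->
    forall x, bracket s (fun y => f y *: t y) x =
              f x *: bracket s t x + anchor (s x) f *: t x }.

(** The Lie algebroid differential, characterised by the Koszul formula.  In the
   second sum the bracket stands in slot [i] instead of slot [0], whence the sign
   [(-1)^j] instead of [(-1)^(i+j)]. *)
Record differential (R : realType) (n : nat) (M : manifold R n)
    (A : vbundle M) (L : lie_algebroid A) := Differential {
  dA : forall i j : int, i + 1 = j -> {linear Om A (oT M) i -> Om A (oT M) j};
  dA_koszul : forall (p : nat) (e : p%:Z + 1 = p.+1%:Z)
      (w : form A (oT M) p) (s : 'I_p.+1 -> section A),
    (forall i, smooth_section (s i)) ->
    forall x,
      ev (dA e w : form A (oT M) p.+1) (fun k => s k x) =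
      \sum_(i < p.+1) (-1) ^+ i *
         anchor L (s i x) (fun y => ev w (fun k => s (lift i k) y)) +
      \sum_(i < p.+1) \sum_(j < p.+1 | (i < j)%N) (-1) ^+ j *
         ev w (fun k : 'I_p => if k == i :> nat then bracket L (s i) (s j) x
                               else s (lift j k) x) }.

(** * Vector bundles over A[1] *)

Section GradedBundle.
Variables (R : realType) (n : nat) (M : manifold R n) (A : vbundle M).

(** A graded vector bundle over A[1], as a sheaf of Z-graded Omega(A)-modules
   which is locally free: [rank x j] is the rank in degree [j] near [x], and a
   local frame around [x] has [rank x j] generators in degree [j].  In the
   expansion of a section of degree [k], a generator of degree [k - p] has a form
   of degree [p] as coefficient; near [x] such forms are zero for [p] greater than
   the rank of [A] at [x]. *)
Record gbundle := GBundle {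
  sec : int -> opens M -> lmodType R;
  res : forall k (U V : opens M), V `<=` U -> {linear sec k U -> sec k V};
  res_id : forall k (U : opens M) (UU : U `<=` U) (b : sec k U), res k UU b = b;
  res_comp : forall k (U V W : opens M) (VU : V `<=` U) (WV : W `<=` V)
    (WU : W `<=` U) (b : sec k U), res k WV (res k VU b) = res k WU b;
  sec_separated : forall k (U : opens M) (I : Type) (V : I -> opens M)
    (VU : forall i, V i `<=` U), (forall x, U x -> exists i, V i x) ->
    forall b b' : sec k U,
    (forall i, res k (VU i) b = res k (VU i) b') -> b = b';
  sec_glue : forall k (U : opens M) (I : Type) (V : I -> opens M)
    (VU : forall i, V i `<=` U), (forall x, U x -> exists i, V i x) ->
    forall b : (forall i, sec k (V i)),
    (forall i j (W : opens M) (Wi : W `<=` V i) (Wj : W `<=` V j),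
       res k Wi (b i) = res k Wj (b j)) ->
    exists b' : sec k U, forall i, res k (VU i) b' = b i;
  act : forall (U : opens M) (p : nat) (k l : int), p%:Z + k = l ->
    {bilinear form A U p -> sec k U -> sec l U};
  act_one : forall (U : opens M) (k : int) (e : 0%:Z + k = k) (b : sec k U),
    act U e (fone A U) b = b;
  act_wedge : forall (U : opens M) p q (k l m : int) (e1 : q%:Z + k = m) (e2 : p%:Z + m = l)
    (e3 : (p + q)%N%:Z + k = l) (w : form A U p) (w' : form A U q)
    (b : sec k U), act U e3 (wedge w w') b = act U e2 w (act U e1 w' b);
  act_res : forall (U V : opens M) (VU : V `<=` U) p (k l : int) (e : p%:Z + k = l)
    (w : form A U p) (b : sec k U),
    res l VU (act U e w b) = act V e (fres VU w) (res k VU b);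
  rank : M -> int -> nat;
  local_frame : forall x : M, exists U : opens M, U x /\
    exists g : (forall j, 'I_(rank x j) -> sec j U),
    forall (V : opens M) (VU : V `<=` U) k (b : sec k V),
    exists! c : (forall p : 'I_(\dim {:A x}).+1,
                   'I_(rank x (k - p%:Z)) -> form A V p),
      b = \sum_(p < (\dim {:A x}).+1) \sum_(a < rank x (k - p%:Z))
            act V (subrKC p%:Z k) (c p a) (res _ VU (g _ a));
  rank_bounded : exists N : int,
    (forall x j, j < N -> rank x j = 0%N) \/
    (forall x j, N < j -> rank x j = 0%N) }.

(** Morphisms of degree [i] of sheaves of graded Omega(A)-modules from the
   restriction of [B] to [U] to that of Omega(A), with the Koszul sign of moving a
   [p]-form past a morphism of degree [i]. *)
Definition hom_family (B : gbundle) (U : opens M) (i : int) :=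
  forall (V : opens M), V `<=` U -> forall j k : int, i + j = k ->
    {linear sec B j V -> Om A V k}.

Record is_hom (B : gbundle) (U : opens M) (i : int) (f : hom_family B U i) :
    Prop := IsHom {
  hom_res : forall (V W : opens M) (VU : V `<=` U) (WU : W `<=` U) (WV : W `<=` V) (j k : int)
    (e : i + j = k) (b : sec B j V),
    Om_res WV (f V VU j k e b) = f W WU j k e (res B j WV b);
  hom_act : forall (V : opens M) (VU : V `<=` U) p (j j' k k' : int)
    (e : i + j = k)
    (e' : i + j' = k') (eb : p%:Z + j = j') (ew : p%:Z + k = k')
    (w : form A V p) (b : sec B j V),
    f V VU j' k' e' (act B V eb w b) =
      (-1) ^+ (p * `|i|) *: Om_wedge ew w (f V VU j k e b) }.

(** [Bs] together with [pr] is the dual vector bundle of [B]: sections of [Bs]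
   over [U] are the same, through the pairing, as Omega(A)-linear morphisms from
   [B] to Omega(A) over [U]. *)
Record dual_pairing (Bs B : gbundle) := DualPairing {
  pr : forall (U : opens M) (i j k : int), i + j = k ->
    {bilinear sec Bs i U -> sec B j U -> Om A U k};
  pr_res : forall (U V : opens M) (VU : V `<=` U) (i j k : int) (e : i + j = k)
    (b : sec Bs i U) (c : sec B j U),
    Om_res VU (pr U e b c) = pr V e (res Bs i VU b) (res B j VU c);
  pr_actl : forall (U : opens M) p (i i' j k k' : int) (e : i + j = k) (e' : i' + j = k')
    (eb : p%:Z + i = i') (ew : p%:Z + k = k')
    (w : form A U p) (b : sec Bs i U) (c : sec B j U),
    pr U e' (act Bs U eb w b) c = Om_wedge ew w (pr U e b c);
  pr_actr : forall (U : opens M) p (i j j' k k' : int) (e : i + j = k) (e' : i + j' = k')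
    (eb : p%:Z + j = j') (ew : p%:Z + k = k')
    (w : form A U p) (b : sec Bs i U) (c : sec B j U),
    pr U e' b (act B U eb w c) =
      (-1) ^+ (p * `|i|) *: Om_wedge ew w (pr U e b c);
  pr_perfect : forall (U : opens M) (i : int) (f : hom_family B U i), is_hom f ->
    exists! b : sec Bs i U, forall (V : opens M) (VU : V `<=` U) (j k : int) (e : i + j = k)
      (c : sec B j V), f V VU j k e c = pr V e (res Bs i VU b) c }.

Variables (L : lie_algebroid A) (d : differential L).

Record amodule (B : gbundle) := AModule {
  Qop : forall i j : int, i + 1 = j ->
    {linear sec B i (oT M) -> sec B j (oT M)};
  Qop_sq : forall (i j k : int) (e : i + 1 = j) (e' : j + 1 = k)
    (b : sec B i (oT M)), Qop e' (Qop e b) = 0;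
  Qop_leibniz : forall (p : nat) (i i' j j' : int) (ed : p%:Z + 1 = p.+1%:Z)
    (eb : p%:Z + i = j) (e : j + 1 = j') (ei : i + 1 = i')
    (e1 : p.+1%:Z + i = j') (e2 : p%:Z + i' = j')
    (w : form A (oT M) p) (b : sec B i (oT M)),
    Qop e (act B (oT M) eb w b) =
      act B (oT M) e1 (dA d ed w : form A (oT M) p.+1) b +
      (-1) ^+ p *: act B (oT M) e2 w (Qop ei b) }.

Definition is_dual_amodule (Bs B : gbundle) (P : dual_pairing Bs B)
    (Q : amodule B) (Qs : amodule Bs) :=
  forall (i i' j j' k k' : int) (e : i + j = k) (ei : i + 1 = i') (ej : j + 1 = j')
    (ek : k + 1 = k') (e1 : i' + j = k') (e2 : i + j' = k')
    (b : sec Bs i (oT M)) (c : sec B j (oT M)),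
    dA d ek (pr P (oT M) e b c) =
      pr P (oT M) e1 (Qop Qs ei b) c + (-1) ^+ `|i|%N *: pr P (oT M) e2 b (Qop Q ej c).

End GradedBundle.

(** * Cohomology of a Z-graded vector space with a degree 1 operator

   [cohomology d k] is the space of cocycles of degree [k] modulo those which are
   coboundaries; this is ker/im when [d] squares to zero, as [Qop] does by
   [Qop_sq] and [dA] does as a consequence of [dA_koszul]. *)

Section Cohomology.
Variables (R : realType) (C : int -> lmodType R).
Variable d : forall i j : int, i + 1 = j -> {linear C i -> C j}.

Definition cocycle_pred (k : int) : {pred C k} :=
  fun b => d (erefl (k + 1)) b == 0.
Arguments cocycle_pred : clear implicits.

Lemma cocycle_submod k : submod_closed (cocycle_pred k).
Proof.
split=> [|a b c /eqP b0 /eqP c0]; apply/eqP; first by rewrite linear0.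
by rewrite linearP b0 c0 scaler0 addr0.
Qed.

HB.instance Definition _ k :=
  GRing.isSubmodClosed.Build R (C k) (cocycle_pred k) (cocycle_submod k).

Record cocycle (k : int) := Cocycle {
  cval : C k;
  cvalP : cval \in cocycle_pred k }.

HB.instance Definition _ k := [isSub for @cval k].
HB.instance Definition _ k := [Choice of cocycle k by <:].
HB.instance Definition _ k := [SubChoice_isSubLmodule of cocycle k by <:].

Definition coboundary_pred (k : int) : {pred cocycle k} :=
  fun b => `[< exists c, cval b = d (subrK 1 k) c >].
Arguments coboundary_pred : clear implicits.

Lemma coboundary_submod k : submod_closed (coboundary_pred k).
Proof.
split=> [|a b b' /asboolP[c bc] /asboolP[c' bc']]; apply/asboolP.
  by exists 0; rewrite linear0.
by exists (a *: c + c'); rewrite linearP -bc -bc'.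
Qed.

HB.instance Definition _ k :=
  GRing.isSubmodClosed.Build R (cocycle k) (coboundary_pred k)
    (coboundary_submod k).

Definition cohomology (k : int) := Quotient.quot (coboundary_pred k).

HB.instance Definition _ k := GRing.Zmodule.on (cohomology k).

Definition cls k (b : cocycle k) : cohomology k := (\pi_(cohomology k) b)%qT.

Definition coh_scale k (a : R) (x : cohomology k) : cohomology k :=
  cls (a *: generic_quotient.repr x).

Lemma coh_scale_cls k a (b : cocycle k) : coh_scale a (cls b) = cls (a *: b).
Proof.
apply/eqP; rewrite -Quotient.idealrBE -scalerBr rpredZ //.
by rewrite Quotient.idealrBE; apply/eqP; rewrite generic_quotient.reprK.
Qed.

Lemma clsD k (b b' : cocycle k) : cls (b + b') = cls b + cls b'.
Proof. exact: (raddfD (\pi_(cohomology k))%qT). Qed.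

Lemma cls_surj k (x : cohomology k) : exists b, x = cls b.
Proof. by exists (generic_quotient.repr x); rewrite /cls generic_quotient.reprK. Qed.

Lemma coh_scaleA k a b (x : cohomology k) :
  coh_scale a (coh_scale b x) = coh_scale (a * b) x.
Proof.
by have [c ->] := cls_surj x; rewrite !coh_scale_cls scalerA.
Qed.

Lemma coh_scale1 k : left_id 1 (@coh_scale k).
Proof. by move=> x; have [c ->] := cls_surj x; rewrite coh_scale_cls scale1r. Qed.

Lemma coh_scaleDr k : right_distributive (@coh_scale k) +%R.
Proof.
move=> a x y; have [b ->] := cls_surj x; have [c ->] := cls_surj y.
by rewrite -clsD !coh_scale_cls scalerDr clsD.
Qed.

Lemma coh_scaleDl k (x : cohomology k) :
  {morph (@coh_scale k)^~ x : a b / a + b}.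
Proof.
by move=> a b; have [c ->] := cls_surj x; rewrite !coh_scale_cls scalerDl clsD.
Qed.

HB.instance Definition _ k := GRing.Zmodule_isLmodule.Build R (cohomology k)
  (@coh_scaleA k) (@coh_scale1 k) (@coh_scaleDr k) (@coh_scaleDl k).

End Cohomology.

(* Main.v *)
(** By the Leibniz rule [d <b, c> = <d b, c> + (-1)^|b| <b, d c>], pairing two
   cocycles gives a cocycle, and for cocycles [b] and [c] one has
   [<d a, c> = d <a, c>] and [<b, d a> = d ((-1)^|b| <b, a>)], so that pairing a
   coboundary with a cocycle gives a coboundary. *)

Require Import Defs.
From HB Require Import structures.
From mathcomp Require Import all_boot all_order all_algebra.
From mathcomp Require Import sesquilinear.
From mathcomp Require Import all_classical all_reals all_analysis.

Set Implicit Arguments.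
Unset Strict Implicit.
Unset Printing Implicit Defensive.

Import GRing.Theory.

Local Open Scope ring_scope.

Section Cocycles.
Variables (R : realType) (C : int -> lmodType R).
Variable d : forall i j : int, i + 1 = j -> {linear C i -> C j}.

(** Being a cocycle is stated with target degree literally [k + 1]; eliminating [e] carries it to
    any degree provably equal to that. *)
Lemma cocycleP k (b : cocycle d k) l (e : k + 1 = l) : d e (cval b) = 0.
Proof. by case: l / e; apply/eqP; exact: cvalP. Qed.

Lemma cls_eq k (b b' : cocycle d k) c :
  cval b - cval b' = d (subrK 1 k) c -> cls b = cls b'.
Proof.
by move=> bb'; apply/eqP; rewrite -Quotient.idealrBE; apply/asboolP; exists c.
Qed.

Lemma cls_eq_boundary k (b b' : cocycle d k) :
  cls b = cls b' -> exists c, cval b - cval b' = d (subrK 1 k) c.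
Proof. by move/eqP; rewrite -Quotient.idealrBE => /asboolP. Qed.

Lemma repr_cls k (x : cohomology d k) : cls (generic_quotient.repr x) = x.
Proof. exact: generic_quotient.reprK. Qed.

Lemma cls_linear k a (b b' : cocycle d k) :
  cls (a *: b + b') = a *: cls b + cls b'.
Proof. by rewrite clsD -coh_scale_cls. Qed.

End Cocycles.

Section CohomologyPairing.
Variables (R : realType) (C1 C2 C3 : int -> lmodType R).
Variable d1 : forall i j : int, i + 1 = j -> {linear C1 i -> C1 j}.
Variable d2 : forall i j : int, i + 1 = j -> {linear C2 i -> C2 j}.
Variable d3 : forall i j : int, i + 1 = j -> {linear C3 i -> C3 j}.
Variable p : forall i j k : int, i + j = k -> {bilinear C1 i -> C2 j -> C3 k}.
Hypothesis p_leibniz : forall (i i' j j' k k' : int) (e : i + j = k)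
    (ei : i + 1 = i') (ej : j + 1 = j') (ek : k + 1 = k')
    (e1 : i' + j = k') (e2 : i + j' = k') (b : C1 i) (c : C2 j),
  d3 ek (p e b c) = p e1 (d1 ei b) c + (-1) ^+ `|i|%N *: p e2 b (d2 ej c).

Variables i j k : int.
Hypothesis e : i + j = k.

Lemma pair_cocycle (b : cocycle d1 i) (c : cocycle d2 j) :
  p e (cval b) (cval c) \in cocycle_pred d3 (k := k).
Proof.
(* The degrees of the two Leibniz terms agree with [k + 1] only propositionally, so the equations
   are supplied by hand. *)
have e1 : i + 1 + j = k + 1 by rewrite addrAC e.
have e2 : i + (j + 1) = k + 1 by rewrite addrA e.
apply/eqP; rewrite (p_leibniz _ (erefl _) (erefl _) _ e1 e2) !cocycleP.
by rewrite linear0l linear0r scaler0 addr0.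
Qed.

Definition cpair b c : cocycle d3 k := Cocycle (pair_cocycle b c).

Lemma cpair_clsl b b' c : cls b = cls b' -> cls (cpair b c) = cls (cpair b' c).
Proof.
move=> /cls_eq_boundary[a Ea].
(* The primitive [a] lives in degree [i - 1], so its pairing with [cval c] lies in degree
   [k - 1]. *)
have e0 : i - 1 + j = k - 1 by rewrite addrAC e.
have e2 : i - 1 + (j + 1) = k by rewrite addrCA subrK addrC.
apply: (@cls_eq _ _ _ _ _ _ (p e0 a (cval c))).
rewrite (p_leibniz _ (subrK 1 i) (erefl _) _ e e2) cocycleP linear0r scaler0.
by rewrite addr0 -Ea linearBl.
Qed.

Lemma cpair_clsr b c c' : cls c = cls c' -> cls (cpair b c) = cls (cpair b c').
Proof.
move=> /cls_eq_boundary[a Ea].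
have e0 : i + (j - 1) = k - 1 by rewrite addrA e.
have e1 : i + 1 + (j - 1) = k by rewrite addrACA subrr addr0.
(* The sign in this primitive squares to 1 against the Leibniz sign. *)
apply: (@cls_eq _ _ _ _ _ _ ((-1) ^+ `|i|%N *: p e0 (cval b) a)).
rewrite linearZZ (p_leibniz _ (erefl _) (subrK 1 j) _ e1 e) cocycleP linear0l.
by rewrite add0r -Ea scalerA -expr2 sqrr_sign scale1r linearBr.
Qed.

Definition coh_pair (x : cohomology d1 i) (y : cohomology d2 j) :
    cohomology d3 k :=
  cls (cpair (generic_quotient.repr x) (generic_quotient.repr y)).

(** The chosen representatives are replaced one slot at a time, passing through the pairing of [b]
    with the representative of [cls c]. *)
Lemma coh_pair_cls b c : coh_pair (cls b) (cls c) = cls (cpair b c).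
Proof.
rewrite /coh_pair (cpair_clsl _ (repr_cls (cls b))).
exact: cpair_clsr (repr_cls (cls c)).
Qed.

Lemma coh_pair_bilinear : bilinear_for *:%R *:%R coh_pair.
Proof.
(* Every class comes from a cocycle, so both identities descend from bilinearity of [p] on the
   underlying values. *)
split=> [y a x x'|x a y y'];
  have [b ->] := cls_surj x; have [c ->] := cls_surj y.
  have [b' ->] := cls_surj x'; rewrite -cls_linear !coh_pair_cls -cls_linear.
  by congr cls; apply: val_inj; rewrite /= linearPl.
have [c' ->] := cls_surj y'; rewrite -cls_linear !coh_pair_cls -cls_linear.
by congr cls; apply: val_inj; rewrite /= linearPr.
Qed.

HB.instance Definition _ :=
  bilinear_isBilinear.Build R _ _ _ *:%R *:%R coh_pair coh_pair_bilinear.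

Definition coh_pairing : {bilinear _ -> _ -> _} := coh_pair.

End CohomologyPairing.

Theorem proposition6p1 (R : realType) (n : nat) (M : manifold R n)
    (A : vbundle M) (L : lie_algebroid A) (d : differential L)
    (B : gbundle A) (Q : amodule d B)
    (Bs : gbundle A) (P : dual_pairing Bs B) (Qs : amodule d Bs)
    (Qs_dual : is_dual_amodule P Q Qs) :
  exists HP : forall i j k : int, i + j = k ->
      {bilinear cohomology (Qop Qs) i -> cohomology (Qop Q) j ->
                cohomology (dA d) k},
    forall (i j k : int) (e : i + j = k)
      (b : cocycle (Qop Qs) i) (c : cocycle (Qop Q) j),
    exists w : cocycle (dA d) k,
      cval w = pr P (oT M) e (cval b) (cval c) /\
      HP i j k e (cls b) (cls c) = cls w.
Proof.
(* [is_dual_amodule] unfolds to [p_leibniz] for global sections, with operators [Qop Qs], [Qop Q]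
   and [dA d]. *)
exists (coh_pairing Qs_dual) => i j k e b c.
by exists (cpair Qs_dual e b c); split=> //; exact: coh_pair_cls.
Qed.
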